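(* Let $m\geq1$ and let $\alpha\in\mathbb R$ be an algebraic number of degree $m$ over $\mathbb Q$, with minimal polynomial $\mu$. Let $(p_1,\dots,p_m)$ be a positive rational basis for $\alpha$, let $M(\cdot)$ denote the associated multiplication matrices, let $\xi\in\mathbb Q[z]_{<m}$ be a polynomial with $M(\xi)>0$ and, if $\alpha>0$, also $M(z\,\xi(z))>0$, and set $Q=M(\xi)$, $A=M(z\,\xi(z))$. Let $N$ be a positive integer with $N\geq\max_{i,j}Q_{ij}$, and define the $m\times m$ absorbing game $\Gamma_\alpha=(g,q,w)$ by $$g_{ij}=0,\qquad q_{ij}=\frac{Q_{ij}}{N}\in(0,1]\cap\mathbb Q,\qquad w_{ij}=\frac{A_{ij}}{Q_{ij}}\in\mathbb Q\qquad\text{for all } i,j\in\{1,\dots,m\}.$$ Then $\Gamma_\alpha$ is a rational, strictly absorbing, and recursive $m\times m$ absorbing game, and its undiscounted value equals $\alpha$. If $\alpha>0$, then $\Gamma_\alpha$ is moreover positive recursive. In particular, any real algebraic number of degree $m\geq1$ is the undiscounted value of a rational $m\times m$ absorbing game.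
   Context: Games. An $m\times n$ (zero-sum) absorbing game is a tuple $\Gamma=(\mathcal I,\mathcal J,g,q,w)$ (also written $(g,q,w)$), where $\mathcal I=\{1,\dots,m\}$ and $\mathcal J=\{1,\dots,n\}$ are the action sets of Player 1 (maximizer) and Player 2 (minimizer), and $g,w\colon\mathcal I\times\mathcal J\to\mathbb R$ and $q\colon\mathcal I\times\mathcal J\to[0,1]$ are the stage payoff, absorbing payoff and absorption probability functions (written $g_{ij},w_{ij},q_{ij}$; $w_{ij}$ is relevant only when $q_{ij}>0$). The game is rational if all $g_{ij},q_{ij},w_{ij}$ are rational; strictly absorbing (also called halting) if $q_{ij}>0$ for all $(i,j)$; recursive if $g_{ij}=0$ for all $(i,j)$; positive recursive if it is recursive and $w_{ij}>0$ whenever $q_{ij}>0$. Dynamics: at each stage $\ell=1,2,\dots$ at which no absorption has yet occurred, the players simultaneously and independently select actions $I_\ell\in\mathcal I$, $J_\ell\in\mathcal J$, the stage payoff is $G_\ell=g(I_\ell,J_\ell)$, and absorption occurs with probability $q(I_\ell,J_\ell)$. If absorption occurs at stage $\ell_0$, then $G_\ell=w(I_{\ell_0},J_{\ell_0})$ for all $\ell>\ell_0$. A (behavior) strategy of Player 1 (resp. Player 2) is a map from finite histories of action pairs (including the empty one) to $\Delta(\mathcal I)$ (resp. $\Delta(\mathcal J)$), where $\Delta(\cdot)$ denotes the set of probability distributions; $\Sigma$ and $\mathcal T$ denote the sets of strategies of Players 1 and 2. For $\lambda\in(0,1]$ the $\lambda$-discounted payoff is $\gamma_\lambda(\sigma,\tau)=\mathbb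 E_{\sigma,\tau}\bigl[\sum_{\ell\ge1}\lambda(1-\lambda)^{\ell-1}G_\ell\bigr]$, and $v_\lambda$ is the value of the game with this payoff. The long-run average payoff is $\gamma(\sigma,\tau)=\mathbb E_{\sigma,\tau}\bigl[\liminf_{L\to\infty}\frac1L\sum_{\ell=1}^LG_\ell\bigr]$. The undiscounted value is $v=\sup_{\sigma\in\Sigma}\inf_{\tau\in\mathcal T}\gamma(\sigma,\tau)=\inf_{\tau\in\mathcal T}\sup_{\sigma\in\Sigma}\gamma(\sigma,\tau)$; it is known (Kohlberg, Mertens–Neyman) that the two sides coincide and that $v=\lim_{\lambda\to0^+}v_\lambda$. Algebra. A real number $\alpha$ is algebraic of degree $m$ over $\mathbb Q$ if it is a root of a rational polynomial of degree $m$ and of no nonzero rational polynomial of smaller degree; its minimal polynomial $\mu\in\mathbb Q[z]$ is the unique monic rational polynomial of degree $m$ with $\mu(\alpha)=0$. $\mathbb R[z]_{<m}$ (resp. $\mathbb Q[z]_{<m}$) denotes the real (resp. rational) polynomials of degree at most $m-1$. The remainder map $\rho\colon\mathbb R[z]\to\mathbb R[z]_{<m}$ sends $f$ to the remainder of its Euclidean division by $\mu$. Writing $\mu(z)=(z-\alpha)\mu_1(z)$, one has $\mu_1(\alpha)\ne0$, and the Lagrange interpolation polynomial is $\ell(z)=\mu_1(z)/\mu_1(\alpha)\in\mathbb R[z]_{<m}$. A positive rational basis for $\alpha$ is a tuple $(p_1,\dots,p_m)\in(\mathbb Q[z]_{<m})^m$ that is a basis of $\mathbb R[z]_{<m}$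 over $\mathbb R$, with $p_k(\alpha)>0$ for every $k$, and such that $\ell=\sum_{k=1}^m\tilde y_kp_k$ with all $\tilde y_k>0$. For $f\in\mathbb R[z]$, the multiplication matrix $M(f)\in\mathbb R^{m\times m}$ is the unique matrix with $\rho(f\,p_j)=\sum_{k=1}^mM(f)_{kj}\,p_k$ for $1\le j\le m$. For a matrix, $M>0$ means every entry is strictly positive. *)

(* Defs.v *)
From HB Require Import structures.
From mathcomp Require Import all_boot all_order all_algebra.
From mathcomp Require Import all_classical all_reals all_analysis.
Set Implicit Arguments.
Unset Strict Implicit.
Unset Printing Implicit Defensive.
Import Order.TTheory GRing.Theory Num.Theory.
Import numFieldNormedType.Exports.
Local Open Scope classical_set_scope.
Local Open Scope ring_scope.

Section ProcessLaw.
Variables (R : realType) (A : finType).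
Local Notation T := (option A).

Definition cylinder (h : seq T) : set (nat -> T) :=
  [set x | mkseq x (size h) = h].

Definition cylinders : set (set (nat -> T)) := range cylinder.

Local Notation trajectory := (g_sigma_algebraType cylinders).

Variable step : seq T -> T -> R.

Definition path_prob (h : seq T) : R :=
  \prod_(k < size h) step (take k h) (nth None h k).

Definition is_law (P : probability trajectory R) : Prop :=
  forall h, P (cylinder h) = (path_prob h)%:E.

End ProcessLaw.

Notation trajectory A := (g_sigma_algebraType (@cylinders A)).

Section LawExists.
Variables (R : realType) (A : finType).
Local Notation T := (option A).
Variable step : seq T -> T -> R.
Hypothesis step_ge0 : forall h t, 0 <= step h t.
Hypothesis step_sum1 : forall h, \sum_t step h t = 1.

Lemma path_prob_rcons h t :
  path_prob step (rcons h t) = path_prob step h * step h t.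
Proof.
rewrite /path_prob size_rcons big_ord_recr/=; congr (_ * _).
  apply: eq_bigr => k _; rewrite nth_rcons ltn_ord -cats1 takel_cat//.
  exact/ltnW.
by rewrite nth_rcons ltnn eqxx -cats1 take_size_cat.
Qed.

Lemma path_prob_ge0 h : 0 <= path_prob step h.
Proof. exact: prodr_ge0. Qed.

Let cum h (k : nat) : R := \sum_(t : T | (enum_rank t < k)%N) step h t.

Let cum0 h : cum h 0 = 0. Proof. by rewrite /cum big_pred0. Qed.

Let cum_card h : cum h #|{: T}| = 1.
Proof.
by rewrite -(step_sum1 h); apply: eq_bigl => t; rewrite ltn_ord.
Qed.

Let cum_le h k l : (k <= l)%N -> cum h k <= cum h l.
Proof.
move=> kl; rewrite /cum [leRHS](bigID (fun t => enum_rank t < k)%N)/=.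
rewrite -[leLHS]addr0 lerD ?sumr_ge0//.
rewrite le_eqVlt; apply/orP; left; apply/eqP/eq_bigl => t.
by rewrite andbC andb_idr// => /leq_trans; apply.
Qed.

Let cumS h t : cum h (enum_rank t).+1 = cum h (enum_rank t) + step h t.
Proof.
rewrite /cum (bigD1 t)//= addrC; congr (_ + _); apply: eq_bigl => s.
by rewrite ltnS ltn_neqAle andbC; congr (_ && _); rewrite -(inj_eq enum_rank_inj).
Qed.

(* Inverse-distribution-function coding: the history h occupies a subinterval
   of [0, 1[ of length path_prob step h, split among its successors. *)
Let lo (h : seq T) : R := \sum_(k < size h)
  path_prob step (take k h) * cum (take k h) (enum_rank (nth None h k)).

Let lo_rcons h t :
  lo (rcons h t) = lo h + path_prob step h * cum h (enum_rank t).
Proof.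
rewrite /lo size_rcons big_ord_recr/=; congr (_ + _).
  apply: eq_bigr => k _; rewrite nth_rcons ltn_ord -cats1 takel_cat//.
  exact/ltnW.
by rewrite nth_rcons ltnn eqxx -cats1 take_size_cat.
Qed.

Let cell h (u : R) := lo h <= u < lo h + path_prob step h.

Let cell_nil u : cell [::] u = (0 <= u < 1).
Proof. by rewrite /cell /lo /path_prob/= !big_ord0 add0r. Qed.

Let cell_rcons_sub h t u : cell (rcons h t) u -> cell h u.
Proof.
rewrite /cell lo_rcons path_prob_rcons -addrA -mulrDr -cumS => /andP[l r].
have p0 := path_prob_ge0 h; apply/andP; split.
  by apply: le_trans l; rewrite lerDl mulr_ge0// -(cum0 h) cum_le.
apply: (lt_le_trans r); rewrite lerD2l ler_piMr// -(cum_card h).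
by rewrite cum_le// ltn_ord.
Qed.

Let cell_rcons_ex h u : cell h u -> exists t, cell (rcons h t) u.
Proof.
move=> /andP[l r].
pose C k := lo h + path_prob step h * cum h k.
have ex : exists k, u < C k by exists #|{: T}|; rewrite /C cum_card mulr1.
have kle : (ex_minn ex <= #|{: T}|)%N.
  by case: ex_minnP => k _; apply; rewrite /C cum_card mulr1.
case: ex_minnP kle => -[|k] uk kmin kle.
  by move: uk; rewrite /C cum0 mulr0 addr0 ltNge l.
exists (enum_val (Ordinal kle)).
rewrite /cell lo_rcons path_prob_rcons -addrA -mulrDr -cumS enum_valK/=.
by rewrite uk andbT leNgt; apply/negP => /kmin; rewrite ltnn.
Qed.

Let cell_rcons_inj h s t u :
  cell (rcons h s) u -> cell (rcons h t) u -> s = t.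
Proof.
have aux s' t' : cell (rcons h s') u -> cell (rcons h t') u ->
    ~~ (enum_rank s' < enum_rank t')%N.
  rewrite /cell !lo_rcons !path_prob_rcons -!addrA -!mulrDr -!cumS.
  move=> /andP[_ r] /andP[l _]; apply/negP => st.
  have := lt_le_trans (le_lt_trans l r) _.
  move=> /(_ (lo h + path_prob step h * cum h (enum_rank t'))).
  by rewrite ltxx lerD2l ler_wpM2l ?path_prob_ge0 ?cum_le//; move=> /(_ isT).
move=> cs ct; apply/enum_rank_inj/val_inj/eqP.
by rewrite eqn_leq leqNgt (aux _ _ ct cs) leqNgt (aux _ _ cs ct).
Qed.

Let next u h : T := odflt None [pick t | cell (rcons h t) u].

Let prefix u := fix F n := if n is k.+1 then rcons (F k) (next u (F k)) else [::].

Let size_prefix u n : size (prefix u n) = n.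
Proof. by elim: n => //= n IH; rewrite size_rcons IH. Qed.

Let code (u : R) : trajectory A := fun n => next u (prefix u n).

Let mkseq_code u n : mkseq (code u) n = prefix u n.
Proof. by elim: n => // n IH; rewrite mkseqS IH. Qed.

Let cell_next h u : cell h u -> cell (rcons h (next u h)) u.
Proof.
move=> /cell_rcons_ex[t ct]; rewrite /next; case: pickP => //= /(_ t).
by rewrite ct.
Qed.

Let cell_prefix u n : 0 <= u < 1 -> cell (prefix u n) u.
Proof.
by move=> u01; elim: n => [|n IH]/=; [rewrite cell_nil|exact: cell_next].
Qed.

Let cell_code h u : 0 <= u < 1 -> (cylinder h (code u) <-> cell h u).
Proof.
move=> u01; rewrite /cylinder/= mkseq_code; split.
  by move=> <-; exact: cell_prefix.
elim/last_ind: h => [//|h t IH] ch; rewrite size_rcons/=.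
have e := IH (cell_rcons_sub ch); rewrite e; congr rcons.
by apply: cell_rcons_inj (ch); apply: cell_next; exact: cell_rcons_sub ch.
Qed.

Let I01 : set (measurableTypeR R) := [set` `[0, 1[%R].
Let code01 : measurableTypeR R -> trajectory A :=
  fun u => if 0 <= u < 1 then code u else (fun=> None).

Let cylinder_code01 h :
  code01 @^-1` cylinder h `&` I01 = [set` `[lo h, lo h + path_prob step h[%R].
Proof.
apply/seteqP; split=> u.
  rewrite /I01/= !in_itv/= => -[]; rewrite /code01 => + u01.
  by rewrite u01 => /(cell_code _ u01).
rewrite /= in_itv/= => ch; have u01 : 0 <= u < 1.
  rewrite -cell_nil; move: ch; rewrite -/(cell h u).
  by elim/last_ind: h => // h t IH /cell_rcons_sub.
rewrite /I01/= in_itv/= u01; split=> //; rewrite /code01 u01.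
exact/(cell_code _ u01).
Qed.

Let measurable_code01 : measurable_fun setT code01.
Proof.
apply: (@measurability _ _ (measurableTypeR R) (trajectory A) setT code01
  (@cylinders A)) => //.
move=> _ [_ [h _ <-] <-]; rewrite setTI.
have -> : code01 @^-1` cylinder h = (code01 @^-1` cylinder h `&` I01) `|`
    (code01 @^-1` cylinder h `\` I01) by rewrite setUIDK.
apply: measurableU; first by rewrite cylinder_code01; exact: measurable_itv.
have [h0|h0] := pselect (cylinder h (fun=> None)).
  suff -> : code01 @^-1` cylinder h `\` I01 = ~` I01.
    by apply: measurableC; exact: measurable_itv.
  apply/seteqP; split=> u; first by case.
  rewrite /I01/= in_itv/= => u01; split => //.
  by rewrite /code01; case: ifP u01.
suff -> : code01 @^-1` cylinder h `\` I01 = set0 by [].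
apply/seteqP; split=> u// -[]; rewrite /I01/= in_itv/= /code01.
by case: ifP.
Qed.

HB.instance Definition _ := @isMeasurableFun.Build _ _ _ _ code01 measurable_code01.

Let mI01 : measurable I01. Proof. exact: measurable_itv. Qed.

Let uniform01 := mrestr (@lebesgue_measure R) mI01.
HB.instance Definition _ := Measure.on uniform01.

Let uniform01_setT : uniform01 setT = 1%E.
Proof.
rewrite /uniform01 /mrestr setTI /I01 lebesgue_measure_itv/= lte_fin ltr01.
by rewrite oppr0 adde0.
Qed.
HB.instance Definition _ :=
  Measure_isProbability.Build _ _ _ uniform01 uniform01_setT.

Lemma law_exists : exists P : probability (trajectory A) R, is_law step P.
Proof.
exists (distribution uniform01 code01) => h.
rewrite /distribution /pushforward /= /uniform01 /mrestr cylinder_code01.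
rewrite lebesgue_measure_itv/= lte_fin ltrDl; case: ifPn => [_|].
  by rewrite -EFinD addrAC subrr add0r.
by rewrite -leNgt => p0; congr EFin; apply/le_anti; rewrite p0 path_prob_ge0.
Qed.

End LawExists.

Lemma law_unique (R : realType) (A : finType) (step : seq (option A) -> option A -> R)
    (P1 P2 : probability (trajectory A) R) :
  is_law step P1 -> is_law step P2 ->
  forall B, measurable B -> P1 B = P2 B.
Proof.
move=> P1E P2E B mB.
pose G := @cylinders A `|` [set set0].
have T0 : cylinder [::] = [set: nat -> option A] by apply/seteqP; split.
apply: (@measure_unique _ R (trajectory A) G (fun=> setT)) => //.
- apply/seteqP; split.
    by apply: smallest_sub => [|C hC]; [exact: smallest_sigma_algebra|
      apply: sub_gen_smallest; left].
  apply: smallest_sub; first exact: smallest_sigma_algebra.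
  move=> C [hC|->]; first exact: sub_gen_smallest.
  exact: (@sigma_algebra0 _ setT).
- move=> _ _ [[h _ <-]|->] [[k _ <-]|->]; rewrite ?set0I ?setI0; try by right.
  wlog hk : h k / (size h <= size k)%N => [wl|].
    have [/wl//|/ltnW/wl] := leqP (size h) (size k).
    by rewrite setIC.
  have [e|ne] := eqVneq (take (size h) k) h.
    left; exists k => //; apply/seteqP; split=> x; last by case.
    rewrite /cylinder/= => xk; split=> //.
    by rewrite -{2}e -xk -map_take take_iota (minn_idPl hk).
  right; apply/seteqP; split=> x //= -[xh xk]; case/eqP: ne.
  by rewrite -xk -map_take take_iota (minn_idPl hk).
- by move=> _; left; exists [::].
- by apply/seteqP; split=> // x _; exists 0%N.
- by move=> _ [[h _ <-]|->]; [exact: etrans (P1E h) (esym (P2E h))|rewrite !measure0].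
- by move=> _; rewrite -ge0_fin_numE// fin_num_measure.
Qed.

Record dist (R : realType) (I : finType) := Dist {
  dist_fun :> I -> R;
  dist_ge0 : forall i, 0 <= dist_fun i;
  dist_sum1 : \sum_i dist_fun i = 1
}.

Record absorbing_game (R : realType) (m n : nat) := AbsorbingGame {
  stage_payoff : 'I_m -> 'I_n -> R;
  absorption_prob : 'I_m -> 'I_n -> R;
  absorbing_payoff : 'I_m -> 'I_n -> R;
  absorption_prob_itv : forall i j, 0 <= absorption_prob i j <= 1
}.

Definition strategy1 (R : realType) (m n : nat) :=
  seq ('I_m * 'I_n) -> dist R 'I_m.
Definition strategy2 (R : realType) (m n : nat) :=
  seq ('I_m * 'I_n) -> dist R 'I_n.

Section Game.
Variables (R : realType) (m n : nat) (G : absorbing_game R m n).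
Local Notation g := (stage_payoff G).
Local Notation q := (absorption_prob G).
Local Notation w := (absorbing_payoff G).

Definition rational_game : Prop :=
  forall i j, [/\ rational (g i j), rational (q i j) & rational (w i j)].

Definition strictly_absorbing : Prop := forall i j, 0 < q i j.

Definition recursive_game : Prop := forall i j, g i j = 0.

Definition positive_recursive : Prop :=
  recursive_game /\ forall i j, 0 < q i j -> 0 < w i j.

(* The record of a stage is Some (i, j, b), where (i, j) is the action pair and
   b tells whether absorption occurs, or None if absorption occurred earlier.
   Stages are numbered from 0. *)
Definition stage : finType := ('I_m * 'I_n * bool)%type.

Definition actions (h : seq (option stage)) : seq ('I_m * 'I_n) :=
  [seq x.1 | x <- pmap id h].

Definition absorbing_pair (h : seq (option stage)) : option ('I_m * 'I_n) :=
  ohead [seq x.1 | x <- pmap id h & x.2].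

Definition stage_prob (s : strategy1 R m n) (t : strategy2 R m n)
    (h : seq (option stage)) (x : option stage) : R :=
  match absorbing_pair h, x with
  | None, Some (i, j, b) => s (actions h) i * t (actions h) j *
                            (if b then q i j else 1 - q i j)
  | Some _, None => 1
  | _, _ => 0
  end.

Lemma stage_prob_ge0 s t h x : 0 <= stage_prob s t h x.
Proof.
rewrite /stage_prob; case: absorbing_pair => [_|]; case: x => [[[i j] b]|]//.
have /andP[q0 q1] := absorption_prob_itv G i j.
by rewrite !mulr_ge0 ?dist_ge0//; case: b => //; rewrite subr_ge0.
Qed.

Lemma stage_prob_sum1 s t h : \sum_x stage_prob s t h x = 1.
Proof.
rewrite /stage_prob (bigD1 None)//=; case: absorbing_pair => [_|].
  by rewrite big1 ?addr0// => -[].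
rewrite add0r (reindex_omap Some id)/=; last by case.
rewrite (eq_bigl xpredT); last by move=> x; rewrite eqxx.
rewrite (eq_bigr (fun x : stage => s (actions h) x.1.1 * t (actions h) x.1.2 *
  (if x.2 then q x.1.1 x.1.2 else 1 - q x.1.1 x.1.2))); last by case=> -[].
rewrite -(pair_bigA _ (fun ij b => s (actions h) ij.1 * t (actions h) ij.2 *
  (if b then q ij.1 ij.2 else 1 - q ij.1 ij.2)))/=.
under eq_bigr do rewrite big_bool/= -mulrDr subrKC mulr1.
rewrite -(pair_bigA _ (fun i j => s (actions h) i * t (actions h) j))/=.
by under eq_bigr do rewrite -mulr_sumr dist_sum1 mulr1; exact: dist_sum1.
Qed.

Definition play_law (s : strategy1 R m n) (t : strategy2 R m n) :
    probability (trajectory stage) R :=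
  sval (cid (law_exists (stage_prob_ge0 s t) (stage_prob_sum1 s t))).

Lemma play_lawP s t : is_law (stage_prob s t) (play_law s t).
Proof. exact: (svalP (cid _)). Qed.

Definition payoff_at (x : trajectory stage) (l : nat) : R :=
  if absorbing_pair (mkseq x l) is Some (i, j) then w i j
  else if x l is Some (i, j, _) then g i j else 0.

Definition mean_payoff (s : strategy1 R m n) (t : strategy2 R m n) : \bar R :=
  (\int[play_law s t]_x
     limn_einf (fun L => (L.+1%:R^-1 * \sum_(l < L.+1) payoff_at x l)%:E))%E.

Definition maxmin : \bar R :=
  ereal_sup [set ereal_inf [set mean_payoff s t | t in setT] | s in setT].

Definition minmax : \bar R :=
  ereal_inf [set ereal_sup [set mean_payoff s t | s in setT] | t in setT].

Definition undiscounted_value (v : R) : Prop :=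
  maxmin = v%:E /\ minmax = v%:E.

End Game.

Section Algebra.
Variable R : realType.

Definition algebraic_of_degree (a : R) (m : nat) : Prop :=
  (exists P : {poly rat}, size P = m.+1 /\ root (map_poly ratr P) a) /\
  (forall P : {poly rat}, P != 0 -> (size P <= m)%N ->
     ~~ root (map_poly ratr P) a).

Definition minimal_polynomial (a : R) (m : nat) (mu : {poly rat}) : Prop :=
  [/\ mu \is monic, size mu = m.+1 & root (map_poly ratr mu) a].

Definition lagrange_poly (a : R) (mu : {poly rat}) : {poly R} :=
  let mu1 := map_poly ratr mu %/ ('X - a%:P) in mu1.[a]^-1 *: mu1.

Definition remainder (mu : {poly rat}) (f : {poly R}) : {poly R} :=
  f %% map_poly ratr mu.

Section Basis.
Variable m : nat.
Variables (mu : {poly rat}) (p : m.-tuple {poly_m rat}).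

Definition real_poly (r : {poly_m rat}) : {poly R} := map_poly ratr (polyn r).

Definition real_basis : m.-tuple {poly_m R} :=
  [tuple of [seq npolyp m (real_poly r) | r <- p]].

Definition positive_rational_basis (a : R) : Prop :=
  [/\ basis_of fullv real_basis,
      forall k, 0 < (real_poly (tnth p k)).[a] &
      exists y : 'I_m -> R, (forall k, 0 < y k) /\
        lagrange_poly a mu = \sum_k y k *: real_poly (tnth p k)].

Definition mult_mx (f : {poly R}) : 'M[R]_m :=
  \matrix_(k, j) coord real_basis k
                   (npolyp m (remainder mu (f * real_poly (tnth p j)))).

Lemma mult_mxP (f : {poly R}) (M : 'M[R]_m) :
    size mu = m.+1 -> basis_of fullv real_basis ->
  M = mult_mx f <->
  forall j, remainder mu (f * real_poly (tnth p j)) =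
            \sum_k M k j *: real_poly (tnth p k).
Proof.
move=> smu bP.
have srem h : (size (remainder mu h) <= m)%N.
  rewrite -ltnS -smu -(size_map_poly (ratr : {rmorphism rat -> R}) mu).
  by rewrite ltn_modp map_poly_eq0 -size_poly_eq0 smu.
have bE (k : 'I_m) : (real_basis`_k : {poly_m R}) = real_poly (tnth p k) :> {poly R}.
  rewrite (nth_map 0) ?size_tuple// -tnth_nth npolypK//.
  by rewrite /real_poly size_map_poly size_npoly.
have sumE (c : 'I_m -> R) : (\sum_k c k *: real_basis`_k : {poly_m R}) =
    \sum_k c k *: real_poly (tnth p k) :> {poly R}.
  by rewrite raddf_sum/=; apply: eq_bigr => k _; rewrite bE.
split=> [-> j|ME].
  under eq_bigr do rewrite mxE.
  rewrite -sumE -(coord_basis bP) ?memvf// npolypK//.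
apply/matrixP => k j; rewrite mxE ME -sumE.
set v := (X in npolyp m X).
have -> : npolyp m v = \sum_k M k j *: real_basis`_k.
  by apply/val_inj; rewrite /= npolypK// size_npoly.
by rewrite coord_sum_free// (basis_free bP).
Qed.

End Basis.
End Algebra.

Definition positive_mx (R : realType) (m n : nat) (M : 'M[R]_(m, n)) : Prop :=
  forall i j, 0 < M i j.

(* Main.v *)
Require Import Defs.
From mathcomp Require Import all_boot all_order all_algebra.
From mathcomp Require Import all_classical all_reals all_analysis.
From mathcomp Require Import ring lra.
Set Implicit Arguments.
Unset Strict Implicit.
Unset Printing Implicit Defensive.
Import Order.TTheory GRing.Theory Num.Theory.
Import numFieldNormedType.Exports.
Local Open Scope ring_scope.

(** If one player's mixed action makes the expectation of [q (w - a)] vanish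
    against every reply, the process worth [w] after absorption and [a] before it
    is a martingale, and since absorption is almost sure the expected long-run
    payoff is exactly [a].  So a game whose
    matrices satisfy [x (A - a Q) = 0] and [(A - a Q) y = 0] with positive [x]
    and [y] has value [a], with [x] and [y] as stationary optimal strategies.

    For multiplication matrices, evaluation at [alpha] gives the left eigenvector
    [p_k(alpha)], and the coordinates of the Lagrange polynomial give the right
    one.  For the existence of a game with value [a], neither a positive basis
    nor [xi] is needed: let [C] be the companion matrix of the minimal
    polynomial, [r] and [u] its left and right eigenvectors for [a].  They satisfy
    [r u = mu'(a) <> 0].  Choose rational matrices [S], with rows close to [r],
    and [T], with columns close to [u], such that [x S = r] and [T y = u] for some
    positive [x] and [y]; then [S T] has all its entries close to [r u], and
    [Q = S T], [A = S C T] will do up to a common sign. *)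

(** * Expectations of functions of finitely many records *)

Section PrefixExpectation.
Local Open Scope classical_set_scope.
Variables (R : realType) (A : finType) (step : seq (option A) -> option A -> R).

(** Under a law of [step], this is the expectation of [f] at the first [n] records. Being a finite
    sum, it allows induction on [n] without integrals. *)
Definition prefix_sum (n : nat) (f : seq (option A) -> R) : R :=
  \sum_(h : n.-tuple (option A)) path_prob step h * f h.

Lemma prefix_sum0 f : prefix_sum 0 f = f [::].
Proof.
rewrite /prefix_sum (big_pred1 [tuple]) => [|h]; last by rewrite [h]tuple0 /= eqxx.
by rewrite /path_prob big_ord0 mul1r.
Qed.

(** Tower property: condition on the first [n] records and average over the next one. *)
Lemma prefix_sumS n f : prefix_sum n.+1 f =
  prefix_sum n (fun h => \sum_t step h t * f (rcons h t)).
Proof.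
rewrite /prefix_sum.
pose snoc (ht : n.-tuple (option A) * option A) := [tuple of rcons ht.1 ht.2].
have snoc_bij : bijective snoc.
  apply: inj_card_bij; last by rewrite card_prod !card_tuple expnSr.
  by move=> [h t] [k s] /(congr1 val)/rcons_inj[/val_inj-> ->].
rewrite (reindex snoc); last exact: onW_bij.
under [RHS]eq_bigr do rewrite mulr_sumr.
rewrite pair_bigA; apply: eq_bigr => -[h t] _ /=.
by rewrite path_prob_rcons mulrA.
Qed.

(** The cylinders of length [n] partition the trajectories, so a function of the first [n] records
    is simple. *)
Lemma prefix_fun_cylinders n (f : seq (option A) -> R) :
  (fun x : trajectory A => (f (mkseq x n))%:E) =
  (fun x => \sum_(h : n.-tuple (option A))
    ((f h)%:E * (\1_(cylinder h : set (trajectory A)) x)%:E))%E.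
Proof.
apply/funext => x; have sx : size (mkseq x n) == n by rewrite size_mkseq.
under eq_bigr do rewrite -EFinM.
rewrite sumEFin (bigD1 (Tuple sx))//= big1 => [|h hx].
  by rewrite indicE mem_set ?mulr1 ?addr0//; rewrite /cylinder/= size_mkseq.
rewrite indicE memNset ?mulr0//; rewrite /cylinder/= size_tuple => xh.
by case/eqP: hx; apply/val_inj; rewrite /= -xh.
Qed.

Lemma measurable_cylinder h : measurable (cylinder h : set (trajectory A)).
Proof. by apply: sub_gen_smallest; exists h. Qed.

Variable P : probability (trajectory A) R.

Lemma integrable_cylinder h :
  P.-integrable setT (fun x => (\1_(cylinder h : set (trajectory A)) x)%:E).
Proof. by apply: integrable_indic; exact: measurable_cylinder. Qed.

Lemma integrable_prefix n f : P.-integrable setT (fun x => (f (mkseq x n))%:E).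
Proof.
rewrite prefix_fun_cylinders; apply: integrable_sum => // h _.
by apply: integrableZl => //; exact: integrable_cylinder.
Qed.

Lemma integral_prefix n f : is_law step P ->
  (\int[P]_x (f (mkseq x n))%:E)%E = (prefix_sum n f)%:E.
Proof.
move=> law_P; rewrite prefix_fun_cylinders integral_sum//= => [|h]; last first.
  by apply: integrableZl => //; exact: integrable_cylinder.
rewrite /prefix_sum -sumEFin; apply: eq_bigr => h _.
rewrite integralZl//; last exact: integrable_cylinder.
rewrite integral_indic ?setIT//; last exact: measurable_cylinder.
by rewrite [X in (_ * X)%E](law_P h) -EFinM mulrC.
Qed.

End PrefixExpectation.

(** * Absorption along a trajectory *)

Section AbsorbingPair.
Variables (m n : nat).
Implicit Types (h : seq (option (stage m n))) (x : trajectory (stage m n)).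

Lemma absorbing_pair_rcons h y :
  absorbing_pair (rcons h y) =
  if absorbing_pair h is Some ij then Some ij
  else if y is Some (ij, true) then Some ij else None.
Proof.
rewrite /absorbing_pair -cats1 pmap_cat filter_cat map_cat.
by case: [seq _ | _ <- _ & _] => //=; case: y => [[ij []]|].
Qed.

Lemma absorbing_pair_mkseq_stable x k l ij : (k <= l)%N ->
  absorbing_pair (mkseq x k) = Some ij -> absorbing_pair (mkseq x l) = Some ij.
Proof.
move=> /subnK <- xk; elim: (l - k)%N => [//|d IH].
by rewrite addSn mkseqS absorbing_pair_rcons IH.
Qed.

End AbsorbingPair.

(** * Long-run payoff under an equalizing pair of strategies *)

Section EqualizingStrategies.
Local Open Scope classical_set_scope.
Variables (R : realType) (m n : nat) (G : absorbing_game R m n).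
Local Notation q := (absorption_prob G).
Local Notation w := (absorbing_payoff G).
Hypothesis G_rec : recursive_game G.
Hypothesis G_abs : strictly_absorbing G.
Variables (s : strategy1 R m n) (t : strategy2 R m n) (a : R).
Hypothesis equalizing : forall h,
  \sum_i \sum_j s h i * t h j * (q i j * (w i j - a)) = 0.

(** Three cases are used: [w, a] gives the martingale, [0, 1] the indicator of survival, and [w, 0]
    the stage payoff of a recursive game. *)
Definition absorbed_value (f : 'I_m -> 'I_n -> R) (c : R)
    (h : seq (option (stage m n))) : R :=
  if absorbing_pair h is Some (i, j) then f i j else c.

(** One-step conditional expectation: the value is frozen once absorption has occurred; otherwise it
    becomes [f] with probability [q] and stays [c] with probability [1 - q]. *)
Lemma stage_prob_absorbed_value f c h :
  \sum_y stage_prob G s t h y * absorbed_value f c (rcons h y) =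
  if absorbing_pair h is Some _ then absorbed_value f c h else
    \sum_i \sum_j s (actions h) i * t (actions h) j *
      (q i j * f i j + (1 - q i j) * c).
Proof.
under eq_bigr do rewrite /absorbed_value absorbing_pair_rcons.
case hE : (absorbing_pair h) => [[i j]|].
  by rewrite /absorbed_value hE -mulr_suml stage_prob_sum1 mul1r.
rewrite (bigD1 None)//= {1}/stage_prob hE mul0r add0r.
rewrite (reindex_omap Some id)/=; last by case.
rewrite (eq_bigl xpredT); last by move=> y; rewrite eqxx.
pose F i j (b : bool) : R := s (actions h) i * t (actions h) j *
  (if b then q i j else 1 - q i j) * (if b then f i j else c).
rewrite (eq_bigr (fun y : stage m n => F y.1.1 y.1.2 y.2)); last first.
  by rewrite /stage_prob hE => -[[i j] []].
rewrite -(pair_bigA _ (fun ij b => F ij.1 ij.2 b))/=.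
rewrite -(pair_bigA _ (fun i j => \sum_b F i j b))/=.
by apply: eq_bigr => i _; apply: eq_bigr => j _; rewrite big_bool /F /=; ring.
Qed.

Lemma dist_prod_sum1 h : \sum_i \sum_j s h i * t h j = 1.
Proof. by under eq_bigr do rewrite -mulr_sumr dist_sum1 mulr1; exact: dist_sum1. Qed.

(** Before absorption, one stage moves the conditional expectation away from [a] by the mean of
    [q (w - a)], which [equalizing] makes zero. *)
Lemma prefix_sum_martingale k :
  prefix_sum (stage_prob G s t) k (absorbed_value w a) = a.
Proof.
elim: k => [|k IH]; first by rewrite prefix_sum0.
rewrite prefix_sumS -[RHS]IH; apply: eq_bigr => h _; congr (_ * _).
rewrite stage_prob_absorbed_value /absorbed_value.
case: absorbing_pair => [//|].
transitivity (\sum_i \sum_j s (actions h) i * t (actions h) j * (q i j * (w i j - a))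
  + (\sum_i \sum_j s (actions h) i * t (actions h) j) * a).
  rewrite mulr_suml -big_split; apply: eq_bigr => i _ /=.
  by rewrite mulr_suml -big_split; apply: eq_bigr => j _ /=; ring.
by rewrite equalizing dist_prod_sum1 add0r mul1r.
Qed.

(** A uniform lower bound on the absorption probabilities, positive because there are finitely many
    action pairs. Starting the minimum at 1 gives [1 - d >= 0]. *)
Let d : R := \big[Num.min/1]_(ij : 'I_m * 'I_n) q ij.1 ij.2.

Let d_gt0 : 0 < d. Proof. by apply: lt_bigmin => // ij _; exact: G_abs. Qed.

Let d_le1 : d <= 1. Proof. exact: bigmin_le_id. Qed.

Let d_le i j : d <= q i j. Proof. exact: (bigmin_le_cond _ (j := (i, j))). Qed.

(** Whatever the actions, an unabsorbed play survives a stage with probability at most [1 - d]. *)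
Lemma prefix_sum_survival k :
  prefix_sum (stage_prob G s t) k (absorbed_value (fun _ _ => 0) 1) <= (1 - d) ^+ k.
Proof.
elim: k => [|k IH]; first by rewrite prefix_sum0 expr0.
rewrite prefix_sumS exprS; apply: le_trans (ler_wpM2l _ IH); last first.
  by rewrite subr_ge0 d_le1.
rewrite mulr_sumr; apply: ler_sum => h _; rewrite mulrCA.
apply: ler_wpM2l; first exact/path_prob_ge0/stage_prob_ge0.
rewrite stage_prob_absorbed_value /absorbed_value.
case: absorbing_pair => [[i j]|]; first by rewrite mulr0.
rewrite mulr1 -[leRHS]mulr1 -[X in _ <= _ * X](dist_prod_sum1 (actions h)).
rewrite mulr_sumr; apply: ler_sum => i _; rewrite mulr_sumr; apply: ler_sum => j _.
rewrite mulr0 add0r mulr1 mulrC.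
by rewrite ler_wpM2r ?mulr_ge0 ?dist_ge0// lerD2l lerN2 d_le.
Qed.

Lemma prefix_sum_survival_ge0 k :
  0 <= prefix_sum (stage_prob G s t) k (absorbed_value (fun _ _ => 0) 1).
Proof.
apply: sumr_ge0 => h _; rewrite mulr_ge0 ?path_prob_ge0//.
  exact: stage_prob_ge0.
by rewrite /absorbed_value; case: absorbing_pair => [[]|].
Qed.

(** Only the records before stage [k] decide whether [w] is paid; otherwise the payoff is
    [g = 0]. *)
Lemma payoff_atE x k : payoff_at G x k = absorbed_value w 0 (mkseq x k).
Proof.
rewrite /payoff_at /absorbed_value; case: absorbing_pair => [//|].
by case: (x k) => [[[i j] b]|//]; exact: G_rec.
Qed.

Lemma expected_payoff_at_cvg :
  (\int[play_law G s t]_x (payoff_at G x k)%:E)%E @[k --> \oo] --> a%:E.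
Proof.
under eq_fun => k.
  under eq_integral do rewrite payoff_atE.
  rewrite (integral_prefix _ _ (play_lawP G s t)).
  (* The stage payoff is the martingale minus [a] on the event of survival, whose probability decays
     geometrically. *)
  have -> : prefix_sum (stage_prob G s t) k (absorbed_value w 0) =
    a - a * prefix_sum (stage_prob G s t) k (absorbed_value (fun _ _ => 0) 1).
    rewrite -{1}(prefix_sum_martingale k) mulr_sumr -sumrB.
    apply: eq_bigr => h _; rewrite /absorbed_value.
    by case: absorbing_pair => [[i j]|]; ring.
  over.
apply: cvg_EFin; first exact: nearW.
rewrite -[X in _ --> X]subr0 -[X in _ --> _ - X](mulr0 a).
apply: cvgB; first exact: cvg_cst.
apply: cvgMr.
have bound_cvg : ((1 - d) ^+ k) @[k --> \oo] --> (0 : R).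
  have := @cvg_geometric R 1 (1 - d); rewrite /geometric/=.
  under eq_fun do rewrite mul1r.
  by apply; rewrite ger0_norm ?subr_ge0// ltrBlDr ltrDl.
apply: squeeze_cvgr (cvg_cst (0 : R)) bound_cvg.
by apply: nearW => k; rewrite prefix_sum_survival_ge0 prefix_sum_survival.
Qed.

(** On every trajectory the payoffs are eventually constant: from absorption on, or always zero if
    it never occurs. *)
Lemma payoff_at_is_cvg x : cvgn (payoff_at G x).
Proof.
have [[k [ij xk]]|unabsorbed] :=
    pselect (exists k ij, absorbing_pair (mkseq x k) = Some ij).
  apply: (is_cvg_near_cst (payoff_at G x k)); near=> l.
  rewrite !payoff_atE /absorbed_value xk (@absorbing_pair_mkseq_stable _ _ x k l ij)//.
  by near: l; exact: nbhs_infty_ge.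
apply: (is_cvg_near_cst 0); apply: nearW => l.
rewrite payoff_atE /absorbed_value; case xl : absorbing_pair => [ij|//].
by case: unabsorbed; exists l, ij.
Unshelve. all: by end_near.
Qed.

(** By Cesàro the liminf of the averages is the pathwise limit of the stage payoffs, and dominated
    convergence identifies its expectation with the limit [a] of the expected stage payoffs. *)
Lemma mean_payoff_equalizing : mean_payoff G s t = a%:E.
Proof.
have meanE x : limn_einf
    (fun L => (L.+1%:R^-1 * \sum_(l < L.+1) payoff_at G x l)%:E)
    = (limn (payoff_at G x))%:E.
  have /cesaro mean_cvg := payoff_at_is_cvg (x := x).
  apply: (cvg_limn_einf_sup _).1; apply: cvg_EFin; first exact: nearW.
  apply: cvg_trans mean_cvg; apply: near_eq_cvg; apply: nearW => L.
  by rewrite /arithmetic_mean /series/= big_mkord.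
rewrite /mean_payoff; under eq_integral do rewrite meanE.
apply: (cvg_unique _ _ expected_payoff_at_cvg) => //.
pose B : R := \sum_i \sum_j `|w i j|.
apply: (@dominated_cvg _ _ _ _ _ measurableT _ _ (fun=> B%:E)) => //.
- move=> k; rewrite (_ : (fun x => _) = fun x => (absorbed_value w 0 (mkseq x k))%:E).
    2: by apply/funext => x; rewrite payoff_atE.
  by have /measurable_int := @integrable_prefix R _ (play_law G s t) k (absorbed_value w 0).
- by move=> x _; apply: cvg_EFin; [exact: nearW|exact: payoff_at_is_cvg].
- exact: finite_measure_integrable_cst.
- move=> k x _; rewrite payoff_atE lee_fin /absorbed_value.
  case: absorbing_pair => [[i j]|]; last by rewrite normr0 !sumr_ge0// => ? _; rewrite sumr_ge0.
  rewrite /B (bigD1 i)//= (bigD1 j)//= -addrA lerDl addr_ge0 ?sumr_ge0// => ? _.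
  exact: sumr_ge0.
Qed.

End EqualizingStrategies.

(** * Games with positive left and right null vectors of [A - a Q] *)

Section PencilGame.
Local Open Scope classical_set_scope.
Variable R : realType.

(** The null vector equations are homogeneous, so the scaling constant [c] can stay unspecified. *)
Lemma normalized_dist (m : nat) (x : 'I_m -> R) : (0 < m)%N ->
  (forall i, 0 < x i) ->
  exists (c : R) (u : dist R 'I_m), forall i, u i = c * x i.
Proof.
move=> m_gt0 x_gt0; have sum_gt0 : 0 < \sum_i x i.
  rewrite (bigD1 (Ordinal m_gt0))//= ltr_pwDl// sumr_ge0// => i _.
  exact: ltW.
have u_ge0 i : 0 <= (\sum_i x i)^-1 * x i by rewrite mulr_ge0 ?invr_ge0 ?ltW.
have u_sum1 : \sum_i (\sum_i x i)^-1 * x i = 1.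
  by rewrite -mulr_sumr mulVf// gt_eqF.
by exists (\sum_i x i)^-1, (Dist u_ge0 u_sum1).
Qed.

Lemma undiscounted_value_pencil (m : nat) (A Q : 'M[R]_m) (a N : R)
    (x : 'I_m -> R) (y : 'I_m -> R)
    (hq : forall i j, 0 <= Q i j / N <= 1) :
  (0 < m)%N -> 0 < N -> positive_mx Q ->
  (forall i, 0 < x i) -> (forall j, 0 < y j) ->
  (forall j, \sum_i x i * A i j = a * \sum_i x i * Q i j) ->
  (forall i, \sum_j A i j * y j = a * \sum_j Q i j * y j) ->
  undiscounted_value
    (AbsorbingGame (fun _ _ => 0) (fun i j => A i j / Q i j) hq) a.
Proof.
move=> m_gt0 N_gt0 Q_gt0 x_gt0 y_gt0 xA Ay.
set G := AbsorbingGame _ _ _.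
have G_rec : recursive_game G by [].
have G_abs : strictly_absorbing G by move=> i j; rewrite divr_gt0.
have [c [u uE]] := normalized_dist m_gt0 x_gt0.
have [e [v vE]] := normalized_dist m_gt0 y_gt0.
(* The factor [Q i j] of [q] cancels the denominator of [w], so the equalizing condition is linear
   in [A] and [Q]. *)
have qwE i j : absorption_prob G i j * (absorbing_payoff G i j - a) =
    N^-1 * (A i j - a * Q i j).
  rewrite /=; field; rewrite (gt_eqF N_gt0) /= gt_eqF//; exact: Q_gt0.
have guaranteed t : mean_payoff G (fun=> u) t = a%:E.
  apply: mean_payoff_equalizing => // h.
  rewrite exchange_big big1//= => j _.
  transitivity (c * t h j * N^-1 *
      (\sum_i x i * A i j - a * \sum_i x i * Q i j)).
    rewrite mulr_sumr -sumrB mulr_sumr; apply: eq_bigr => i _.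
    by rewrite qwE uE; ring.
  by rewrite xA subrr mulr0.
have defended s : mean_payoff G s (fun=> v) = a%:E.
  apply: mean_payoff_equalizing => // h; rewrite big1//= => i _.
  transitivity (e * s h i * N^-1 *
      (\sum_j A i j * y j - a * \sum_j Q i j * y j)).
    rewrite mulr_sumr -sumrB mulr_sumr; apply: eq_bigr => j _.
    by rewrite qwE vE; ring.
  by rewrite Ay subrr mulr0.
(* Playing [u] secures exactly [a] against every [t], and [v] exactly [a] against every [s]; this
   bounds both [maxmin] and [minmax] from either side. *)
split; apply/le_anti/andP; split.
- apply: ge_ereal_sup => _ [s _ <-]; rewrite -(defended s).
  by apply: ereal_inf_lbound; exists (fun=> v).
- apply: le_ereal_sup_tmp; exists (ereal_inf [set mean_payoff G (fun=> u) t | t in setT]).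
    by exists (fun=> u).
  by apply: le_ereal_inf_tmp => _ [t _ <-]; rewrite guaranteed.
- apply: (@le_trans _ _ (ereal_sup [set mean_payoff G s (fun=> v) | s in setT])).
    by apply: ereal_inf_lbound; exists (fun=> v).
  by apply: ge_ereal_sup => _ [s _ <-]; rewrite defended.
- apply: le_ereal_inf_tmp => _ [t _ <-]; rewrite -(guaranteed t).
  by apply: ereal_sup_ubound; exists (fun=> u).
Qed.

End PencilGame.

(** * Eigenvectors and rationality of multiplication matrices *)

Section MultiplicationMatrix.
Variables (R : realType) (m : nat) (mu : {poly rat}) (p : m.-tuple {poly_m rat}).
Hypothesis size_mu : size mu = m.+1.
Hypothesis p_basis : basis_of fullv (real_basis R p).
Local Notation rp k := (real_poly R (tnth p k)).

Lemma size_real_poly (r : {poly_m rat}) : (size (real_poly R r) <= m)%N.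
Proof. by rewrite /real_poly size_map_poly size_npoly. Qed.

Lemma real_basis_sum (c : 'I_m -> R) :
  (\sum_k c k *: (real_basis R p)`_k : {poly_m R}) = \sum_k c k *: rp k :> {poly R}.
Proof.
rewrite raddf_sum/=; apply: eq_bigr => k _; congr (_ *: _).
by rewrite (nth_map 0) ?size_tuple// -tnth_nth npolypK// size_real_poly.
Qed.

Lemma real_basis_sum_inj (c d : 'I_m -> R) :
  \sum_k c k *: rp k = \sum_k d k *: rp k -> c =1 d.
Proof.
rewrite -!real_basis_sum => /val_inj cd k.
by rewrite -(coord_sum_free c k (basis_free p_basis)) cd coord_sum_free ?(basis_free p_basis).
Qed.

Lemma mult_mx_sum f j : remainder mu (f * rp j) = \sum_k mult_mx mu p f k j *: rp k.
Proof. by have /mult_mxP := erefl (mult_mx mu p f); apply. Qed.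

(** Evaluate the relation defining column [j] at [a]: reduction modulo [mu] does not change the
    value at a root of [mu]. *)
Lemma mult_mx_left_eigen (a : R) f j : root (map_poly ratr mu) a ->
  \sum_k (rp k).[a] * mult_mx mu p f k j = f.[a] * (rp j).[a].
Proof.
move=> mu_a; have /(congr1 (horner^~ a)) := mult_mx_sum f j.
rewrite horner_sum => eq_a; under eq_bigr do rewrite mulrC -hornerZ.
rewrite -eq_a -hornerM [in RHS](divp_eq (f * rp j) (map_poly ratr mu)).
by rewrite hornerD hornerM (rootP mu_a) mulr0 add0r.
Qed.

(** The Lagrange polynomial is a multiple of [mu / (X - a)], and [X - a] divides [f - f(a)]. Hence
    [f] multiplies it modulo [mu] as the scalar [f(a)]; comparing coordinates gives the claim. *)
Lemma mult_mx_right_eigen (a : R) (y : 'I_m -> R) f k :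
  root (map_poly ratr mu) a ->
  lagrange_poly a mu = \sum_j y j *: rp j ->
  \sum_j mult_mx mu p f k j * y j = f.[a] * y k.
Proof.
move=> mu_a lagE; move: k; apply: real_basis_sum_inj.
transitivity (remainder mu (f * lagrange_poly a mu)).
  rewrite lagE mulr_sumr /remainder.
  rewrite (big_morph _ (@modpD _ _) (@mod0p _ _)).
  under [RHS]eq_bigr => j _.
    rewrite -scalerAr modpZl -/(remainder _ _) mult_mx_sum scaler_sumr.
    over.
  rewrite exchange_big; apply: eq_bigr => k _; rewrite scaler_suml.
  by apply: eq_bigr => j _; rewrite scalerA mulrC.
under eq_bigr do rewrite -scalerA; rewrite -scaler_sumr -lagE.
have muE : map_poly ratr mu %/ ('X - a%:P) * ('X - a%:P) = map_poly ratr mu :> {poly R}.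
  by rewrite divpK// dvdp_XsubCl.
(* Its degree is below that of [mu], so the scaled Lagrange polynomial is its own remainder. *)
have lag_small : (size (f.[a] *: lagrange_poly a mu) < size (map_poly ratr mu : {poly R}))%N.
  rewrite size_map_poly size_mu ltnS; apply: leq_trans (size_scale_leq _ _) _.
  apply: leq_trans (size_scale_leq _ _) _.
  by rewrite size_divp ?polyXsubC_eq0// size_map_poly size_mu size_XsubC subn1.
rewrite /remainder -[RHS](modp_small lag_small); apply/eqP.
rewrite -subr_eq0 -modpN -modpD -mul_polyC -mulrBl.
have : root (f - (f.[a])%:P) a by rewrite rootE !hornerE subrr.
case/factor_theorem => h ->; rewrite /lagrange_poly -scalerAr modpZl.
by rewrite -mulrA [('X - _) * _]mulrC muE modp_mull scaler0.
Qed.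

(** The coordinates solve a linear system whose matrix [B] of basis coefficients and right-hand side
    are rational. Independence over [R] makes [B] invertible, already over the rationals. *)
Lemma rational_coord (s : {poly rat}) (c : 'I_m -> R) :
  map_poly ratr s = \sum_k c k *: rp k -> forall k, rational (c k).
Proof.
move=> sE k; pose B : 'M[rat]_m := \matrix_(l, i) (tnth p l : {poly rat})`_i.
have mulB (d : 'I_m -> R) :
    \row_l d l *m map_mx ratr B = \row_i (\sum_l d l *: rp l)`_i.
  apply/rowP => i; rewrite !mxE coef_sum; apply: eq_bigr => l _.
  by rewrite !mxE coefZ coef_map.
have B_unit : B \in unitmx.
  rewrite -(map_unitmx (ratr : {rmorphism rat -> R})) -row_free_unit.
  apply: inj_row_free => v; have -> : v = \row_l v 0 l.
    by apply/rowP => l; rewrite mxE.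
  rewrite mulB => /rowP v0; apply/rowP => l; rewrite !mxE.
  apply: (real_basis_sum_inj (d := fun=> 0)) => {l}.
  under [RHS]eq_bigr do rewrite scale0r; rewrite big1_eq.
  apply/polyP => i; rewrite coef0; have [im|mi] := ltnP i m.
    by have := v0 (Ordinal im); rewrite !mxE.
  rewrite nth_default//; apply: leq_trans (size_sum _ _ _) _.
  apply/bigmax_leqP => l _; apply: leq_trans (size_scale_leq _ _) _.
  by apply: leq_trans mi; exact: size_real_poly.
have cE : \row_l c l = map_mx ratr (\row_i s`_i *m invmx B).
  rewrite map_mxM map_invmx; apply: (canRL (mulmxK _)); first by rewrite map_unitmx.
  by rewrite mulB -sE; apply/rowP => i; rewrite !mxE coef_map.
by exists ((\row_i s`_i *m invmx B) 0 k) => //; have /rowP/(_ k) := cE; rewrite !mxE.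
Qed.

Lemma mult_mx_rational (f : {poly rat}) k j :
  rational (mult_mx mu p (map_poly (ratr : rat -> R) f) k j).
Proof.
apply: (rational_coord (s := (f * tnth p j) %% mu) (c := fun k => mult_mx mu p _ k j)).
by rewrite -mult_mx_sum /remainder map_modp rmorphM.
Qed.

End MultiplicationMatrix.

(** * The game built from multiplication matrices *)

Lemma rational_div (R : realType) (x y : R) :
  rational x -> rational y -> rational (x / y).
Proof. by move=> [a _ <-] [b _ <-]; exists (a / b) => //; rewrite fmorph_div. Qed.

Lemma rational_nat (R : realType) (k : nat) : rational (k%:R : R).
Proof. by exists k%:R => //; rewrite rmorph_nat. Qed.

Lemma multiplication_game (R : realType) (m : nat) (alpha : R) (mu : {poly rat})
    (p : m.-tuple {poly_m rat}) (xi : {poly_m rat}) (N : nat) :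
  (0 < m)%N -> minimal_polynomial alpha m mu -> positive_rational_basis mu p alpha ->
  let Q : 'M[R]_m := mult_mx mu p (real_poly R xi) in
  let A : 'M[R]_m := mult_mx mu p ('X * real_poly R xi) in
  positive_mx Q -> (0 < alpha -> positive_mx A) ->
  (0 < N)%N -> (forall i j, Q i j <= N%:R) ->
  exists hq : forall i j, 0 <= Q i j / N%:R <= 1,
    let Gamma := AbsorbingGame (fun _ _ => 0) (fun i j => A i j / Q i j) hq in
    [/\ rational_game Gamma, strictly_absorbing Gamma, recursive_game Gamma,
        undiscounted_value Gamma alpha &
        0 < alpha -> positive_recursive Gamma].
Proof.
move=> m_gt0 [_ size_mu mu_alpha] [p_basis p_gt0 [y [y_gt0 lagE]]] Q A.
move=> Q_gt0 A_gt0 N_gt0 Q_le.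
have N_gt0R : 0 < N%:R :> R by rewrite ltr0n.
have hq i j : 0 <= Q i j / N%:R <= 1.
  by rewrite divr_ge0 ?(ltW (Q_gt0 i j))//= ler_pdivrMr// mul1r.
have Q_rat i j : rational (Q i j) by exact: mult_mx_rational.
have A_rat i j : rational (A i j).
  by rewrite /A /real_poly -(map_polyX ratr) -rmorphM; exact: mult_mx_rational.
exists hq; split=> //.
- move=> i j; split; [exact: (@rational_nat _ 0)|apply: rational_div|exact: rational_div].
  + exact: Q_rat.
  + exact: rational_nat.
- by move=> i j; rewrite divr_gt0.
(* [Q] and [A] share these eigenvectors, with eigenvalues [xi(alpha)] and [alpha * xi(alpha)]. *)
- apply: (@undiscounted_value_pencil _ _ _ _ _ _
      (fun k => (real_poly R (tnth p k)).[alpha]) y) => // [j|i].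
  + by rewrite !mult_mx_left_eigen// hornerM hornerX mulrA.
  + by rewrite !(mult_mx_right_eigen size_mu p_basis _ _ mu_alpha lagE)// hornerM hornerX mulrA.
- by move=> /A_gt0 A_pos; split=> // i j _; rewrite divr_gt0.
Qed.

(** * A rational game for every real algebraic number *)

Section Realization.
Variable R : realType.

(* The columns of T are the vertices of a small rational simplex, obtained by
   moving a rational approximation of u along the coordinate axes, which
   contains u in its interior. *)
Lemma rational_simplex (m : nat) (u : 'I_m -> R) (i0 : 'I_m) (e : R) :
  0 < e -> u i0 = 1 ->
  exists (T : 'M[rat]_m) (y : 'I_m -> R),
    [/\ forall k, 0 < y k, forall i, \sum_k ratr (T i k) * y k = u i &
        forall i k, `|ratr (T i k) - u i| < e].
Proof.
move=> e_gt0 u_i0; have m_gt0 : (0 < m)%N by exact: leq_ltn_trans (ltn_ord i0).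
have m_gt0R : 0 < m%:R :> R by rewrite ltr0n.
(* One half of [e] is for the error of the approximation [b], the other for the shift by [h] along
   the axes. *)
have [h] : exists h : rat, ratr h \in `]0, (e / 2)[ by apply: rat_in_itvoo; rewrite divr_gt0.
rewrite in_itv/= => /andP[h_gt0 h_lt].
(* Approximating from below makes the [d i] nonnegative, and an error under [h / m] keeps their sum
   below 1. *)
have approx i : exists q : rat, (i == i0 -> q = 1) /\
    0 <= u i - ratr q < ratr h / m%:R.
  have [->|ne] := eqVneq i i0.
    by exists 1; rewrite rmorph1 u_i0 subrr lexx divr_gt0.
  have [q] : exists q : rat, ratr q \in `](u i - ratr h / m%:R), (u i)[.
    by apply: rat_in_itvoo; rewrite ltrBlDr ltrDl divr_gt0.
  rewrite in_itv/= => /andP[q_gt q_lt]; exists q; split=> //.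
  by rewrite subr_ge0 (ltW q_lt) ltrBlDr -ltrBlDl.
have [b bP] := choice approx.
have b_i0 : b i0 = 1 by apply: (bP i0).1.
pose d i : R := (u i - ratr (b i)) / ratr h.
have d_ge0 i : 0 <= d i by have [_ /andP[? _]] := bP i; rewrite divr_ge0// ltW.
have d_lt i : d i < m%:R^-1.
  by have [_ /andP[_ ?]] := bP i; rewrite ltr_pdivrMr// mulrC.
have d_i0 : d i0 = 0 by rewrite /d b_i0 u_i0 rmorph1 subrr mul0r.
(* For weights [y] of sum 1, the matrix [T] below sends [y] to [b i + h * (y i - y i0)]. So
   [y i - y i0] must be [d i], and the total weight forces [y i0 = y0]. *)
pose y0 : R := (1 - \sum_i d i) / m%:R.
have sum_d_lt1 : \sum_i d i < 1.
  have -> : 1 = \sum_(i < m) m%:R^-1 :> R.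
    by rewrite sumr_const card_ord -[_ *+ _]mulr_natl mulfV ?gt_eqF.
  by apply: ltr_sum => [|i _]; [apply/hasP; exists i0; rewrite ?mem_index_enum|exact: d_lt].
have y0_gt0 : 0 < y0 by rewrite divr_gt0 ?subr_gt0.
exists (\matrix_(i, k) (b i + h * ((k == i)%:R - (k == i0)%:R))), (fun k => y0 + d k).
split.
- by move=> k; rewrite ltr_pwDl.
- move=> i.
  have sum_y : \sum_k (y0 + d k) = 1.
    rewrite big_split sumr_const card_ord -[_ *+ _]mulr_natl /y0 /=.
    by rewrite mulrCA mulfV ?gt_eqF// mulr1 subrK.
  have pick_y l : \sum_k (k == l)%:R * (y0 + d k) = y0 + d l.
    rewrite (bigD1 l)//= eqxx mul1r big1 ?addr0// => k /negbTE->.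
    by rewrite mul0r.
  transitivity (ratr (b i) * (\sum_k (y0 + d k)) + ratr h *
      (\sum_k (k == i)%:R * (y0 + d k) - \sum_k (k == i0)%:R * (y0 + d k))).
    rewrite -sumrB !mulr_sumr -big_split; apply: eq_bigr => k _ /=.
    by rewrite mxE rmorphD rmorphM rmorphB !rmorph_nat; ring.
  rewrite sum_y !pick_y d_i0 /d mulr1 addr0 [y0 + _]addrC addrK mulrC.
  by rewrite divfK ?gt_eqF// addrC subrK.
- move=> i k; rewrite mxE rmorphD rmorphM rmorphB !rmorph_nat /=.
  have [_ /andP[b_ge b_lt]] := bP i.
  have hm_le : ratr h / m%:R <= ratr h :> R.
    by rewrite ler_pdivrMr// ler_peMr ?(ltW h_gt0)// ler1n.
  have c_le : (k == i)%:R - (k == i0)%:R <= 1 :> R by case: eqP; case: eqP => _ _ /=; lra.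
  have c_ge : - 1 <= (k == i)%:R - (k == i0)%:R :> R by case: eqP; case: eqP => _ _ /=; lra.
  have := ler_wpM2l (ltW h_gt0) c_le; have := ler_wpM2l (ltW h_gt0) c_ge.
  rewrite mulrN1 mulr1 ltr_norml; move: (_ * _) => hc hc_ge hc_le.
  by apply/andP; split; lra.
Qed.

Lemma rational_rank_one_factors (m : nat) (r u : 'I_m -> R) (i0 j0 : 'I_m) :
  r i0 = 1 -> u j0 = 1 -> \sum_k r k * u k != 0 ->
  exists (S T : 'M[rat]_m) (sgn : rat) (x y : 'I_m -> R),
    [/\ forall i j, 0 < sgn * (S *m T) i j,
        forall i, 0 < x i, forall j, 0 < y j,
        forall k, \sum_i x i * ratr (S i k) = r k &
        forall k, \sum_j ratr (T k j) * y j = u k].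
Proof.
move=> r_i0 u_j0; set D := \sum_k _ => D_neq0.
pose K : R := \sum_k (`|r k| + `|u k| + 1).
have K_gt0 : 0 < K.
  have term_gt0 k : 0 < `|r k| + `|u k| + 1 by rewrite ltr_wpDl ?addr_ge0.
  by rewrite /K (bigD1 i0)//= ltr_pwDl// sumr_ge0.
have D_gt0 : 0 < `|D| by rewrite normr_gt0.
(* Chosen so that [e < 1] and [e * K < |D|]: the first bounds the quadratic error term by [e], the
   second then keeps every entry of the product within [|D|] of [D], hence of the same sign. *)
pose e := `|D| / (`|D| + K).
have DK_gt0 : 0 < `|D| + K by rewrite addr_gt0.
have e_gt0 : 0 < e by rewrite divr_gt0.
have e_lt1 : e < 1 by rewrite ltr_pdivrMr// mul1r ltrDl.
have eK_lt : e * K < `|D|.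
  by rewrite /e mulrAC ltr_pdivrMr// ltr_pM2l// ltrDr.
have [S' [x [x_gt0 Sx S_near]]] := rational_simplex e_gt0 r_i0.
have [T [y [y_gt0 Ty T_near]]] := rational_simplex e_gt0 u_j0.
have prod_near i j : `|ratr ((S'^T *m T) i j) - D| < `|D|.
  apply: le_lt_trans eK_lt; rewrite mxE rmorph_sum /D -sumrB mulr_sumr.
  apply: le_trans (ler_norm_sum _ _ _) _; apply: ler_sum => k _.
  rewrite rmorphM /= mxE; have := ltW (T_near k j); have := ltW (S_near k i).
  move: (ratr (S' k i)) (ratr (T k j)) => s t hs ht.
  have -> : s * t - r k * u k = (s - r k) * (t - u k) + ((s - r k) * u k + r k * (t - u k)).
    by ring.
  have -> : e * (`|r k| + `|u k| + 1) = e * 1 + (e * `|u k| + `|r k| * e) by ring.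
  apply: le_trans (ler_normD _ _) _; rewrite lerD//.
    by rewrite normrM ler_pM// (le_trans ht (ltW e_lt1)).
  apply: le_trans (ler_normD _ _) _; rewrite !normrM lerD//.
    by rewrite ler_wpM2r.
  by rewrite ler_wpM2l.
exists S'^T, T, (if 0 < D then 1 else -1), x, y; split=> //.
- move=> i j; rewrite -(ltr_rat R) rmorph0 rmorphM /=.
  have := prod_near i j; rewrite ltr_norml => /andP[lo hi].
  have [D_pos|D_neg|D0] := ltgtP 0 D.
  + by rewrite rmorph1; move: lo hi; rewrite gtr0_norm//; lra.
  + by rewrite rmorphN1; move: lo hi; rewrite ltr0_norm//; lra.
  + by rewrite -D0 eqxx in D_neq0.
- by move=> k; rewrite -Sx; apply: eq_bigr => i _; rewrite mxE mulrC.
Qed.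

(** With [x S = r] and [T y = u], one gets [x S C T = r C T = a r T = a x S T], and symmetrically on
    the right with [y]. *)
Lemma rational_pencil_game (m : nat) (C : 'M[rat]_m) (a : R) (r u : 'I_m -> R)
    (i0 j0 : 'I_m) :
  r i0 = 1 -> u j0 = 1 -> \sum_k r k * u k != 0 ->
  (forall j, \sum_i r i * ratr (C i j) = a * r j) ->
  (forall i, \sum_j ratr (C i j) * u j = a * u i) ->
  exists G : absorbing_game R m m, rational_game G /\ undiscounted_value G a.
Proof.
move=> r_i0 u_j0 ru rC Cu.
have [S [T [c [x [y [cST_gt0 x_gt0 y_gt0 xS Ty]]]]]] := rational_rank_one_factors r_i0 u_j0 ru.
pose Q0 := c *: (S *m T); pose A0 := c *: (S *m C *m T).
pose Q : 'M[R]_m := map_mx ratr Q0; pose A : 'M[R]_m := map_mx ratr A0.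
have Q_gt0 i j : 0 < Q i j by rewrite mxE ltr0q mxE.
(* The entries are positive, so their sum bounds each of them; the successor of its integer part is
   a positive integer above it. *)
pose N : R := (Num.truncn (\sum_i \sum_j Q i j)).+1%:R.
have N_gt0 : 0 < N by rewrite ltr0n.
have Q_le i j : Q i j <= N.
  apply: le_trans (ltW (truncnS_gt _)).
  rewrite (bigD1 i)//= (bigD1 j)//= -addrA lerDl addr_ge0 ?sumr_ge0// => l _.
    exact: ltW.
  by rewrite sumr_ge0// => l' _; exact: ltW.
have hq i j : 0 <= Q i j / N <= 1.
  by rewrite divr_ge0 ?(ltW (Q_gt0 i j)) ?(ltW N_gt0)//= ler_pdivrMr// mul1r.
exists (AbsorbingGame (fun _ _ => 0) (fun i j => A i j / Q i j) hq); split.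
  have Q_rat i j : rational (Q i j) by exists (Q0 i j); rewrite ?mxE.
  move=> i j; split; [exact: (@rational_nat _ 0)|apply: rational_div => //|apply: rational_div => //].
    exact: rational_nat.
  by exists (A0 i j); rewrite ?mxE.
have m_gt0 : (0 < m)%N by exact: leq_ltn_trans (ltn_ord i0).
pose SR := map_mx (ratr : rat -> R) S; pose TR := map_mx (ratr : rat -> R) T.
pose CR := map_mx (ratr : rat -> R) C.
have QE : Q = ratr c *: (SR *m TR) by rewrite /Q map_mxZ map_mxM.
have AE : A = ratr c *: (SR *m CR *m TR) by rewrite /A map_mxZ !map_mxM.
have rowE (z : 'I_m -> R) (M : 'M[R]_m) j :
    \sum_i z i * M i j = (\row_i z i *m M) 0 j.
  by rewrite mxE; apply: eq_bigr => i _; rewrite mxE.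
have colE (z : 'I_m -> R) (M : 'M[R]_m) i :
    \sum_j M i j * z j = (M *m \col_j z j) i 0.
  by rewrite mxE; apply: eq_bigr => j _; rewrite mxE.
have xSR : \row_i x i *m SR = \row_i r i.
  by apply/rowP => k; rewrite -rowE mxE -xS; apply: eq_bigr => i _; rewrite mxE.
have TRy : TR *m \col_j y j = \col_j u j.
  by apply/colP => k; rewrite -colE mxE -Ty; apply: eq_bigr => i _; rewrite mxE.
have rCR : \row_i r i *m CR = a *: \row_i r i.
  by apply/rowP => k; rewrite -rowE !mxE -rC; apply: eq_bigr => i _; rewrite mxE.
have CRu : CR *m \col_j u j = a *: \col_j u j.
  by apply/colP => k; rewrite -colE !mxE -Cu; apply: eq_bigr => i _; rewrite mxE.
apply: (@undiscounted_value_pencil _ _ _ _ _ _ x y) => // [j|i].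
- rewrite !rowE AE QE -!scalemxAr !mulmxA xSR rCR -scalemxAl.
  by rewrite [LHS]mxE [in LHS]mxE [in RHS]mxE mulrCA.
- rewrite !colE AE QE -!scalemxAl -!mulmxA TRy CRu -scalemxAr.
  by rewrite [LHS]mxE [in LHS]mxE [in RHS]mxE mulrCA.
Qed.

(** The companion matrix has left eigenvector the powers of [a] and right eigenvector the
    coefficients of [mu1 = mu / (X - a)]; their pairing is [mu1(a)]. *)
Lemma algebraic_game (m : nat) (a : R) : (0 < m)%N -> algebraic_of_degree a m ->
  exists G : absorbing_game R m m, rational_game G /\ undiscounted_value G a.
Proof.
case: m => [//|n] _ [[P [size_P P_a]] minimal].
have P_neq0 : P != 0 by rewrite -size_poly_eq0 size_P.
have lcP_neq0 : lead_coef P != 0 by rewrite lead_coef_eq0.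
pose mu := (lead_coef P)^-1 *: P.
have size_mu : size mu = n.+2 by rewrite size_scale ?invr_eq0.
have mu_monic : mu`_n.+1 = 1.
  by rewrite coefZ -[n.+1]/(n.+2.-1) -size_P mulVf.
have mu_a : root (map_poly ratr mu) a by rewrite map_polyZ rootZ ?fmorph_eq0 ?invr_eq0.
have [mu1 muE] := factor_theorem _ _ mu_a.
have size_mu1 : size mu1 = n.+1.
  have : size (map_poly ratr mu : {poly R}) = n.+2 by rewrite size_map_poly.
  rewrite muE; have [->|mu1_neq0] := eqVneq mu1 0; first by rewrite mul0r size_poly0.
  by rewrite size_Mmonic ?monicXsubC// size_XsubC addn2 => -[].
(* [mu1(a)] is the value at [a] of the derivative of [mu], a nonzero rational polynomial of too
   small a degree to vanish there. *)
have mu1_a : mu1.[a] != 0.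
  have -> : mu1.[a] = (map_poly ratr mu^`()).[a].
    by rewrite -deriv_map muE derivM derivXsubC mulr1 hornerD hornerM hornerXsubC
      subrr mulr0 add0r.
  apply: minimal.
    apply/eqP => /polyP/(_ n); rewrite coef_deriv mu_monic coef0 => /eqP.
    by rewrite pnatr_eq0.
  by rewrite -ltnS -size_mu lt_size_deriv// -size_poly_eq0 size_mu.
(* Synthetic division: compare coefficients in [mu = mu1 * (X - a)]. *)
have coef_mu i : ratr mu`_i = (if i == 0 then 0 else mu1`_i.-1) - a * mu1`_i :> R.
  rewrite -coef_map muE mulrBr coefB coefMX mulrC mul_polyC coefZ.
  by [].
have mu1_monic : mu1`_n = 1.
  have := coef_mu n.+1; rewrite mu_monic rmorph1 /= [mu1`_n.+1]nth_default ?size_mu1//.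
  by rewrite mulr0 subr0.
(* Column [j] holds the coordinates of [X * X^j] modulo [mu] in the monomial basis. *)
pose C : 'M[rat]_n.+1 :=
  \matrix_(i, j) ((i == j.+1 :> nat)%:R - (j == ord_max)%:R * mu`_i).
(* The entries equal to 1 are [a ^+ 0] and the leading coefficient of [mu1]. *)
apply: (@rational_pencil_game _ C a (fun i => a ^+ i) (fun i => mu1`_i) ord0 ord_max) => //.
- by under eq_bigr do rewrite mulrC; rewrite -horner_coef_wide ?size_mu1.
- move=> j; rewrite -exprS.
  under eq_bigr do rewrite mxE rmorphB rmorphM !rmorph_nat mulrBr.
  rewrite sumrB; have [->|j_lt] := eqVneq j ord_max.
    rewrite big1 => [|i _]; last by rewrite ltn_eqF ?mulr0//= ltn_ord.
    have := rootP mu_a; rewrite horner_coef size_map_poly size_mu big_ord_recr/=.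
    rewrite coef_map /= mu_monic rmorph1 mul1r => /eqP; rewrite addr_eq0 => /eqP sumE.
    rewrite sub0r -[RHS]opprK -sumE; congr (- _); apply: eq_bigr => i _.
    by rewrite coef_map mul1r mulrC.
  have j1_lt : (j.+1 < n.+1)%N by rewrite ltnS ltn_neqAle j_lt -ltnS ltn_ord.
  rewrite [X in _ - X]big1 => [|i _]; last by rewrite mul0r mulr0.
  rewrite (bigD1 (Ordinal j1_lt))//= eqxx mulr1 big1 ?addr0 ?subr0// => i.
  by rewrite -val_eqE/= => /negbTE->; rewrite mulr0.
- move=> i; under eq_bigr do rewrite mxE rmorphB rmorphM !rmorph_nat mulrBl.
  rewrite sumrB [X in _ - X](bigD1 ord_max)//= eqxx mul1r mu1_monic mulr1.
  rewrite [X in _ - (_ + X)]big1 => [|j /negbTE->]; last by rewrite !mul0r.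
  rewrite addr0 coef_mu opprB addrCA -[RHS]addr0; congr (_ + _).
  case: i => -[|i] /= i_lt.
    by rewrite subr0 big1// => j _; rewrite mul0r.
  have i_lt' : (i < n.+1)%N by exact: ltnW.
  rewrite (bigD1 (Ordinal i_lt'))//= eqxx mul1r big1 ?addr0 ?subrr// => j.
  by rewrite -val_eqE/= eqSS eq_sym => /negbTE->; rewrite mul0r.
Qed.

End Realization.

Theorem theorem2 (R : realType) :
  (forall (m : nat) (alpha : R) (mu : {poly rat}) (p : m.-tuple {poly_m rat})
          (xi : {poly_m rat}) (N : nat),
     (0 < m)%N ->
     algebraic_of_degree alpha m ->
     minimal_polynomial alpha m mu ->
     positive_rational_basis mu p alpha ->
     let Q : 'M[R]_m := mult_mx mu p (real_poly R xi) in
     let A : 'M[R]_m := mult_mx mu p ('X * real_poly R xi) in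
     positive_mx Q ->
     (0 < alpha -> positive_mx A) ->
     (0 < N)%N ->
     (forall i j, Q i j <= N%:R) ->
     exists hq : forall i j, 0 <= Q i j / N%:R <= 1,
       let Gamma := AbsorbingGame (fun _ _ => 0)
                      (fun i j => A i j / Q i j) hq in
       [/\ rational_game Gamma, strictly_absorbing Gamma, recursive_game Gamma,
           undiscounted_value Gamma alpha &
           0 < alpha -> positive_recursive Gamma])
  /\
  (forall (m : nat) (alpha : R),
     (0 < m)%N ->
     algebraic_of_degree alpha m ->
     exists Gamma : absorbing_game R m m,
       rational_game Gamma /\ undiscounted_value Gamma alpha).
Proof.
split; last exact: algebraic_game.
move=> m alpha mu p xi N m_gt0 _ mu_min p_basis Q A.
exact: multiplication_game.
Qed.
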